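(* Let $n\ge 2$, $c>0$ and $m\in\{1,\dots,n-1\}$. Then the norm $|A|$ of the second fundamental form of the Clifford minimal hypersurface $$S^m\!\left(\sqrt{\tfrac{m}{cn}}\right)\times S^{n-m}\!\left(\sqrt{\tfrac{n-m}{cn}}\right)\subset\mathbb{S}^{n+1}(c)$$ satisfies the Simons' equation $$|A|\,\Delta|A|+|A|^4=\frac{2}{n}\,\bigl|\nabla|A|\bigr|^2+nc\,|A|^2 .$$
   Context: $\mathbb{S}^{n+1}(c)=\{x\in\mathbb{R}^{n+2}: x_1^2+\cdots+x_{n+2}^2=1/c\}$ with the induced metric (constant sectional curvature $c$). $S^q(r)\subset\mathbb{R}^{q+1}$ is the sphere of radius $r$ centered at the origin, and the product is embedded in $\mathbb{S}^{n+1}(c)$ via $\mathbb{R}^{n+2}=\mathbb{R}^{m+1}\times\mathbb{R}^{n-m+1}$. $A=(h_{ij})$ is the second fundamental form of the hypersurface in $\mathbb{S}^{n+1}(c)$, $|A|^2=\sum_{i,j}h_{ij}^2$ in an orthonormal frame, and $\Delta$, $\nabla$ are the Laplacian (trace of the Hessian) and gradient of the induced metric on the hypersurface. *)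

(* Defs.v *)
From HB Require Import structures.
From mathcomp Require Import all_boot all_order all_algebra.
From mathcomp Require Import all_classical all_reals all_analysis.

Set Implicit Arguments.
Unset Strict Implicit.
Unset Printing Implicit Defensive.

Import Order.TTheory GRing.Theory Num.Theory.
Import numFieldNormedType.Exports.

Local Open Scope classical_set_scope.
Local Open Scope ring_scope.

(* Differential geometry of subsets M of R^k that are embedded submanifolds.
   Fields and functions on M are represented by total functions on R^k, but
   every construction below only looks at their values on M.  The norm of
   'rV[R]_k in MathComp-Analysis is the sup norm: it is only used for the
   topology and for differentiation, and all metric notions go through dotp. *)
Section Submanifolds.
Variables (R : realType) (k : nat).
Local Notation E := 'rV[R]_k.
Implicit Types (M N T : set E) (p u v w z : E) (Y nu : E -> E) (f : E -> R).

Definition dotp u v : R := \sum_(i < k) u 0 i * v 0 i.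

Definition sphere (r : R) : set E := [set x | dotp x x = r ^+ 2].

Definition curve_in M p v (g : R -> E) : Prop :=
  [/\ \forall t \near (0 : R), M (g t), g 0 = p & is_derive (0 : R) 1 g v].

Definition tangent M p : set E := [set v | exists g, curve_in M p v g].

Section Derivative.
Variables (W : normedModType R) (M : set E).
Implicit Types F : E -> W.

Definition is_mderive F p v (d : W) : Prop :=
  forall g, curve_in M p v g -> is_derive (0 : R) 1 (F \o g) d.

(* For an embedded submanifold M this is (Frechet) differentiability at p of
   the restriction of F to M. *)
Definition mdifferentiable F p : Prop :=
  exists dF : {linear E -> W},
    forall v, tangent M p v -> is_mderive F p v (dF v).

(* dF_p(v); unspecified (zero) if there is no such derivative. *)
Definition mderive F p v : W := xget 0 [set d | is_mderive F p v d].

End Derivative.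

(* Orthogonal projection of z onto the linear subspace T. *)
Definition tproj T z : E :=
  xget 0 [set u | T u /\ forall w, T w -> dotp (z - u) w = 0].

(* Levi-Civita covariant derivative in N, along v in T_pM, of a field Y
   tangent to N defined on the submanifold M of N. *)
Definition covd N M Y p v : E := tproj (tangent N p) (mderive M Y p v).

(* The rows of e form an orthonormal basis of T. *)
Definition orthonormal_basis d T (e : 'M[R]_(d, k)) : Prop :=
  e *m e^T = 1%:M /\ forall v, T v <-> (v <= e)%MS.

(* An arbitrary orthonormal frame at p of the d-dimensional manifold M. *)
Definition frame d M p : 'M[R]_(d, k) :=
  xget 0 [set e | orthonormal_basis (tangent M p) e].

Definition unit_normal_field N M nu : Prop :=
  forall p, M p ->
    [/\ tangent N p (nu p), dotp (nu p) (nu p) = 1,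
        forall v, tangent M p v -> dotp (nu p) v = 0 &
        mdifferentiable M nu p].

(* Second fundamental form of the hypersurface M of N, with respect to the
   unit normal field nu (Weingarten formula). *)
Definition second_form N M nu p v w : R := - dotp (covd N M nu p v) w.

Definition norm_second_form d N M nu p : R :=
  let e := frame d M p in
  Num.sqrt (\sum_(i < d) \sum_(j < d)
              second_form N M nu p (row i e) (row j e) ^+ 2).

Definition grad M f p : E :=
  xget 0 [set u | tangent M p u /\
                  forall v, tangent M p v -> mderive M f p v = dotp u v].

Definition hess M f p v w : R := dotp (covd M M (grad M f) p v) w.

Definition laplacian d M f p : R :=
  let e := frame d M p in \sum_(i < d) hess M f p (row i e) (row i e).

End Submanifolds.

(* The ambient sphere S^(n+1)(c) in R^(m+1) x R^(n-m+1) = R^(n+2). *)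
Definition space_form (R : realType) (n m : nat) (c : R) :
    set 'rV[R]_(m.+1 + (n - m).+1) :=
  [set x | dotp x x = 1 / c].

Definition clifford (R : realType) (n m : nat) (c : R) :
    set 'rV[R]_(m.+1 + (n - m).+1) :=
  [set x | sphere (Num.sqrt (m%:R / (c * n%:R))) (lsubmx x) /\
           sphere (Num.sqrt ((n - m)%:R / (c * n%:R))) (rsubmx x)].

Arguments space_form {R} n m c.
Arguments clifford {R} n m c.

(* Main.v *)
(* At p = (x, y) the tangent space of M is the product of the orthogonal
   complements of x and y, so that the unit normals of M in the ambient sphere
   are +/- (alpha x, beta y) for constants alpha, beta.  A differentiable unit
   normal field is therefore eps (alpha x, beta y), where eps is differentiable
   along curves and has square 1, hence zero derivative.  So the shape operator
   is, up to sign, (alpha id, beta id), and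
   |A|^2 = alpha^2 m + beta^2 (n - m) = n c is constant on M: the derivatives of
   |A| vanish and the equation reduces to |A|^4 = n c |A|^2. *)

Require Import Defs.
From mathcomp Require Import all_boot all_order all_algebra.
From mathcomp Require Import all_classical all_reals all_analysis.
From mathcomp Require Import ring lra zify.
Import Order.TTheory GRing.Theory Num.Theory.
Import numFieldNormedType.Exports.
Local Open Scope classical_set_scope.
Local Open Scope ring_scope.

Set Implicit Arguments.
Unset Strict Implicit.
Unset Printing Implicit Defensive.

(** * Algebra of the Euclidean inner product *)

Section Dotp.
Context {R : realType} {k : nat}.
Implicit Types (u v w : 'rV[R]_k) (a : R).

Lemma dotpE u v : dotp u v = (u *m v^T) 0 0.
Proof. by rewrite mxE; apply: eq_bigr => i _; rewrite mxE. Qed.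

Lemma mul_tr_dotp u v : u *m v^T = (dotp u v)%:M.
Proof. by rewrite dotpE [LHS]mx11_scalar. Qed.

Lemma dotpC u v : dotp u v = dotp v u.
Proof. by apply: eq_bigr => i _; rewrite mulrC. Qed.

Lemma dotpDl u v w : dotp (u + v) w = dotp u w + dotp v w.
Proof. by rewrite !dotpE mulmxDl mxE. Qed.

Lemma dotpZl a u v : dotp (a *: u) v = a * dotp u v.
Proof. by rewrite !dotpE -scalemxAl mxE. Qed.

Lemma dotpNl u v : dotp (- u) v = - dotp u v.
Proof. by rewrite -scaleN1r dotpZl mulN1r. Qed.

Lemma dotp0l v : dotp 0 v = 0.
Proof. by rewrite -(scale0r v) dotpZl mul0r. Qed.

Lemma dotpDr u v w : dotp w (u + v) = dotp w u + dotp w v.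
Proof. by rewrite ![dotp w _]dotpC dotpDl. Qed.

Lemma dotpZr a u v : dotp u (a *: v) = a * dotp u v.
Proof. by rewrite ![dotp u _]dotpC dotpZl. Qed.

Lemma dotpNr u v : dotp u (- v) = - dotp u v.
Proof. by rewrite ![dotp u _]dotpC dotpNl. Qed.

Lemma dotp0r v : dotp v 0 = 0.
Proof. by rewrite dotpC dotp0l. Qed.

Lemma dotp_ge0 u : 0 <= dotp u u.
Proof. by apply: sumr_ge0 => i _; rewrite -expr2 sqr_ge0. Qed.

Lemma dotp_eq0 u : dotp u u = 0 -> u = 0.
Proof.
move=> /eqP; rewrite psumr_eq0 => [/allP u0|i _]; last by rewrite -expr2 sqr_ge0.
apply/rowP => i; rewrite mxE; have := u0 i (mem_index_enum i).
by rewrite mulf_eq0 orbb => /eqP.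
Qed.

(** The component of [v] orthogonal to [u] is orthogonal to [u] and hence to [v], so it is
    orthogonal to itself and vanishes. *)
Lemma perp_perp u v : 0 < dotp u u ->
  (forall w, dotp u w = 0 -> dotp v w = 0) ->
  v = (dotp u v / dotp u u) *: u.
Proof.
move=> u0 vu; apply/eqP; rewrite -subr_eq0; apply/eqP.
set w := v - _; have uw : dotp u w = 0.
  by rewrite dotpDr dotpNr dotpZr divfK ?subrr ?gt_eqF.
by apply: dotp_eq0; rewrite {1}/w dotpDl dotpNl dotpZl uw mulr0 subr0 vu.
Qed.

End Dotp.

Lemma dotp_row_mx (R : realType) k1 k2 (u1 v1 : 'rV[R]_k1) (u2 v2 : 'rV[R]_k2) :
  dotp (row_mx u1 u2) (row_mx v1 v2) = dotp u1 v1 + dotp u2 v2.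
Proof. by rewrite !dotpE tr_row_mx mul_row_col mxE. Qed.

Lemma dotp_submx (R : realType) k1 k2 (u v : 'rV[R]_(k1 + k2)) :
  dotp u v = dotp (lsubmx u) (lsubmx v) + dotp (rsubmx u) (rsubmx v).
Proof. by rewrite -dotp_row_mx !hsubmxK. Qed.

(** * Orthonormal bases of hyperplanes and the orthogonal projections they define *)

Section OrthonormalBases.
Context {R : realType}.

Lemma hyperplane_orthonormal k (u : 'rV[R]_(1 + k)) : 0 < dotp u u ->
  exists B : 'M[R]_(k, 1 + k), orthonormal_basis [set v | dotp u v = 0] B.
Proof.
move=> u_gt0.
(* Both normalizations of [u] have the same orthogonal complement as [u]; the sign is chosen so that
   the first coordinate is not 1, which keeps the reflection vector [w] below nonzero. *)
have [u' [u'1 u'0 u'u]] : exists u' : 'rV[R]_(1 + k),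
    [/\ dotp u' u' = 1, u' 0 0 != 1 & forall v, dotp u v = 0 <-> dotp u' v = 0].
  have s0 : Num.sqrt (dotp u u) != 0 by rewrite gt_eqF ?sqrtr_gt0.
  have scaled b : b ^+ 2 = (dotp u u)^-1 ->
      dotp (b *: u) (b *: u) = 1 /\
      forall v, dotp u v = 0 <-> dotp (b *: u) v = 0.
    move=> b2; rewrite dotpZl dotpZr mulrA -expr2 b2 mulVf ?gt_eqF//; split => // v.
    rewrite dotpZl; split=> [->|/eqP]; first by rewrite mulr0.
    rewrite mulf_eq0 => /orP[/eqP b0|/eqP//].
    by move: b2; rewrite b0 expr0n/= => /esym/eqP; rewrite invr_eq0 gt_eqF.
  have s2 : (Num.sqrt (dotp u u))^-1 ^+ 2 = (dotp u u)^-1.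
    by rewrite exprVn sqr_sqrtr ?ltW.
  have [s1|s1] := eqVneq (((Num.sqrt (dotp u u))^-1 *: u) 0 0) 1; last first.
    by have [] := scaled _ s2; exists ((Num.sqrt (dotp u u))^-1 *: u).
  have [] := scaled (- (Num.sqrt (dotp u u))^-1); first by rewrite sqrrN.
  move=> p1 p2; exists (- (Num.sqrt (dotp u u))^-1 *: u); split => //.
  by rewrite scaleNr mxE s1 lt_eqF//; lra.
(* [H] is the Householder reflection exchanging the first basis vector and u':
   it is orthogonal, its first row is u' and its other rows form the basis. *)
pose w := u' - delta_mx 0 0.
pose H : 'M[R]_(1 + k) := 1%:M - (1 - u' 0 0)^-1 *: (w^T *m w).
have nz : 1 - u' 0 0 != 0 by rewrite subr_eq0 eq_sym.
(* Thus [H] is the usual 1 - 2 w^T w / |w|^2. *)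
have ww : dotp w w = (1 - u' 0 0) * 2.
  have d1 v : dotp v (delta_mx 0 0) = v 0 0.
    rewrite /dotp (bigD1 0)//= big1 => [|i /negPf i0].
      by rewrite mxE !eqxx addr0 mulr1.
    by rewrite mxE i0 andbF mulr0.
  rewrite /w !(dotpDl, dotpDr, dotpNl, dotpNr) !d1 (dotpC (delta_mx 0 0)) d1 u'1.
  rewrite mxE !eqxx/=.
  ring.
have trH : H^T = H by rewrite /H linearB linearZ/= trmx1 trmx_mul trmxK.
have HH : H *m H = 1%:M.
  have : (w^T *m w) *m (w^T *m w) = ((1 - u' 0 0) * 2) *: (w^T *m w).
    by rewrite mulmxA -[w^T *m w *m w^T]mulmxA mul_tr_dotp ww mul_mx_scalar scalemxAl.
  rewrite /H; move: (w^T *m w) => Z ZZ.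
  rewrite mulmxBl mul1mx mulmxBr mulmx1 -scalemxAl -scalemxAr ZZ !scalerA.
  rewrite [_ * (_ * 2)](_ : _ = (1 - u' 0 0)^-1 * 2); last by field.
  rewrite -addrA -opprD -scalerBl -scalerDl [X in X *: Z](_ : _ = 0).
    by rewrite scale0r subr0.
  ring.
have uH : usubmx H = u'.
  apply/rowP => j; rewrite !mxE big_ord1 !mxE lshift0 !eqxx.
  rewrite (_ : ord0 = 0)//= (eq_sym 0 j).
  by field.
have Hu : H = col_mx u' (dsubmx H) by rewrite -uH vsubmxK.
move: Hu; set B := dsubmx H => Hu.
(* Read as H H^T = 1, the identity [HH] makes the rows of [B] orthonormal and orthogonal to [u'];
   read as H^T H = 1, it decomposes every vector along [u'] and the rows of [B]. *)
have := HH; rewrite -{2}trH Hu tr_col_mx mul_col_row scalar_mx_block.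
move=> /eq_block_mx[_ _ Bu BB].
have := HH; rewrite -{1}trH Hu tr_col_mx mul_row_col => uB.
exists B; split=> // v; rewrite /= u'u; split=> [u'v|/submxP[y ->]].
  rewrite -[v]mulmx1 -uB mulmxDr !mulmxA mul_tr_dotp dotpC u'v raddf0 mul0mx add0r.
  exact: submxMl.
by rewrite dotpC dotpE -mulmxA Bu mulmx0 mxE.
Qed.

(** Both sides are the matrix of the orthogonal projection onto [T]. Each projection absorbs the
    other, and transposing one of these two identities makes them equal. *)
Lemma orthonormal_basis_proj k d d' (T : set 'rV[R]_k)
    (e : 'M[R]_(d, k)) (f : 'M[R]_(d', k)) :
  orthonormal_basis T e -> orthonormal_basis T f -> e^T *m e = f^T *m f.
Proof.
have absorb d1 d2 (g : 'M[R]_(d1, k)) (h : 'M[R]_(d2, k)) :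
    orthonormal_basis T g -> orthonormal_basis T h ->
    g^T *m g *m (h^T *m h) = g^T *m g.
  move=> [_ gT] [hh hT].
  have /submxP[y ->] : (g <= h)%MS.
    by apply/row_subP => i; apply/hT/gT; exact: row_sub.
  by rewrite !mulmxA -[_ *m h *m h^T]mulmxA hh mulmx1.
move=> eT fT; rewrite -(absorb _ _ _ _ fT eT).
have /(congr1 trmx) := absorb _ _ _ _ eT fT.
by rewrite !trmx_mul !trmxK !mulmxA.
Qed.

End OrthonormalBases.

(** * Derivatives of vector-valued curves, and curves on round spheres *)

Section Derivatives.
Context {R : realType}.

Lemma is_derive_mxP m n (g : R -> 'M[R]_(m, n)) (t : R) (d : 'M[R]_(m, n)) :
  is_derive t 1 g d <-> forall i j, is_derive t 1 (fun s => g s i j) (d i j).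
Proof.
split=> [[gt <-] i j|gd].
  by split; [exact: (derivable_mxP _ _ _).1|rewrite derive_mx// mxE].
have gt : derivable g t 1 by apply/derivable_mxP => i j; case: (gd i j).
split => //; rewrite derive_mx//; apply/matrixP => i j; rewrite mxE.
by case: (gd i j).
Qed.

Lemma is_derive_mull (f g : R -> R) (t df dg : R) :
  is_derive t 1 f df -> is_derive t 1 g dg ->
  is_derive t 1 (fun s => f s * g s) (df * g t + f t * dg).
Proof.
move=> fd gd; rewrite (_ : (fun _ => _) = f * g)//; apply: is_derive_eq.
by rewrite addrC; congr (_ + _); exact: mulrC.
Qed.

Lemma is_derive_scale m n (f : R -> R) (g : R -> 'M[R]_(m, n)) (t df : R) dg :
  is_derive t 1 f df -> is_derive t 1 g dg ->
  is_derive t 1 (fun s => f s *: g s) (df *: g t + f t *: dg).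
Proof.
move=> fd /is_derive_mxP gd; apply/is_derive_mxP => i j.
rewrite !mxE; under eq_fun do rewrite mxE; exact: is_derive_mull.
Qed.

Lemma is_derive_mulmx m n (B : 'M[R]_(m, n)) (g : R -> 'rV[R]_m) (t : R) dg :
  is_derive t 1 g dg -> is_derive t 1 (fun s => g s *m B) (dg *m B).
Proof.
move=> /is_derive_mxP gd; apply/is_derive_mxP => i j.
rewrite mxE; under eq_fun do rewrite mxE.
rewrite (_ : (fun _ => _) = \sum_k (fun s => g s i k * B k j)); last first.
  by apply/funext => s; rewrite fct_sumE.
apply: is_derive_sum => k; apply: is_derive_eq.
by rewrite scaler0 add0r; exact: mulrC.
Qed.

Lemma is_derive_dotp k (f g : R -> 'rV[R]_k) (t : R) df dg :
  is_derive t 1 f df -> is_derive t 1 g dg ->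
  is_derive t 1 (fun s => dotp (f s) (g s)) (dotp df (g t) + dotp (f t) dg).
Proof.
move=> /is_derive_mxP fd /is_derive_mxP gd; rewrite /dotp -big_split/=.
rewrite (_ : (fun _ => _) = \sum_i (fun s => f s 0 i * g s 0 i)); last first.
  by apply/funext => s; rewrite fct_sumE.
by apply: is_derive_sum => i; exact: is_derive_mull.
Qed.

Lemma is_derive_row_mx k1 k2 (f : R -> 'rV[R]_k1) (g : R -> 'rV[R]_k2) (t : R)
    df dg :
  is_derive t 1 f df -> is_derive t 1 g dg ->
  is_derive t 1 (fun s => row_mx (f s) (g s)) (row_mx df dg).
Proof.
move=> /is_derive_mxP fd /is_derive_mxP gd; apply/is_derive_mxP => i j.
rewrite mxE; under eq_fun do rewrite mxE.
by case: splitP => l _; [exact: fd|exact: gd].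
Qed.

(* The rational (stereographic) parametrization of the circle needs no case
   distinction on [v = 0], unlike the unit speed one. *)
Lemma sphere_curve k (p v : 'rV[R]_k) : 0 < dotp p p -> dotp p v = 0 ->
  exists g : R -> 'rV[R]_k,
    [/\ forall t, dotp (g t) (g t) = dotp p p, g 0 = p & is_derive (0 : R) 1 g v].
Proof.
(* With this [s], |v|^2 t^2 = 4 s t^2 |p|^2, so the vector (1 - s t^2) p + t v has squared norm (1 +
   s t^2)^2 |p|^2. *)
move=> p0 pv; pose s := dotp v v / (4 * dotp p p).
have s0 : 0 <= s by rewrite divr_ge0 ?mulr_ge0 ?dotp_ge0.
have D0 (t : R) : 1 + s * t ^+ 2 != 0.
  by rewrite gt_eqF// ltr_pwDl// mulr_ge0// sqr_ge0.
pose D := fun t : R => (1 + s * t ^+ 2)^-1.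
have dsq (a : R) : is_derive (0 : R) 1 (fun t : R => 1 + a * t ^+ 2) 0.
  by apply: is_derive_eq; rewrite scale0r addr0 scaler0 mulr0.
have dD : is_derive (0 : R) 1 D 0.
  apply: is_derive_eq; first exact: is_deriveV.
  exact: mulr0.
exists (fun t : R => (D t * (1 - s * t ^+ 2)) *: p + (D t * t) *: v); split.
- move=> t; rewrite !(dotpDl, dotpDr, dotpZl, dotpZr) (dotpC v p) pv.
  have -> : dotp v v = 4 * s * dotp p p by rewrite /s; field; rewrite gt_eqF.
  by rewrite /D; field.
- by rewrite /D expr0n/= !(mulr0, subr0, addr0, invr1, mulr1, scale0r, scale1r).
- have dN : is_derive (0 : R) 1 (fun t : R => 1 - s * t ^+ 2) 0.
    by under eq_fun do rewrite -mulNr; exact: dsq.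
  apply: is_derive_eq.
    exact: is_deriveD (is_derive_scale (is_derive_mull dD dN) (is_derive_cst p _ _))
      (is_derive_scale (is_derive_mull dD (is_derive_id _ _)) (is_derive_cst v _ _)).
  rewrite /D expr0n/= !(mulr0, subr0, addr0, invr1, mulr1, mul0r, add0r, mul1r).
  by rewrite !(scale0r, scaler0, scale1r, addr0, add0r).
Qed.

End Derivatives.

(** * Evaluating the choice-based derivative, projection, gradient and Laplacian *)

Section Submanifolds.
Context {R : realType} {k : nat}.
Implicit Types (M T : set 'rV[R]_k) (p u v : 'rV[R]_k).

(** Tangency of [v] provides a curve, and uniqueness of the derivative along it forces the value
    chosen by [xget]. *)
Lemma mderiveE (W : normedModType R) M (F : 'rV[R]_k -> W) p v d :
  tangent M p v -> is_mderive M F p v d -> mderive M F p v = d.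
Proof.
move=> [g gM] Fd; apply: xget_unique => // d' Fd'.
by have [_ <-] := Fd _ gM; have [_ <-] := Fd' _ gM.
Qed.

Lemma is_mderive_eq_on (W : normedModType R) M (F G : 'rV[R]_k -> W) p v d :
  (forall x, M x -> F x = G x) -> is_mderive M F p v d -> is_mderive M G p v d.
Proof.
move=> FG Fd g gM; have [Mg _ _] := gM.
by apply: near_eq_is_derive (Fd _ gM); near=> t; apply: FG; near: t.
Unshelve. all: by end_near. Qed.

Lemma is_mderive_cst_on (W : normedModType R) M (F : 'rV[R]_k -> W) w p v :
  (forall x, M x -> F x = w) -> is_mderive M F p v 0.
Proof.
move=> Fw; apply: (@is_mderive_eq_on _ M (cst w)) => [x /Fw//|g _].
exact: is_derive_cst.
Qed.

Lemma mdifferentiable_cst_on (W : normedModType R) M (F : 'rV[R]_k -> W) w p :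
  (forall x, M x -> F x = w) -> mdifferentiable M F p.
Proof. by move=> Fw; exists \0 => v _; apply: is_mderive_cst_on Fw. Qed.

Lemma tproj_id T u : (forall v w, T v -> T w -> T (v - w)) -> T u ->
  tproj T u = u.
Proof.
move=> TB Tu; apply: xget_unique => [|v [Tv uv]].
  by split=> // w _; rewrite subrr dotp0l.
by apply/esym/eqP; rewrite -subr_eq0; apply/eqP/dotp_eq0/uv/TB.
Qed.

(** Differentiate the constant function |g|^2 along a curve g in [M]. *)
Lemma tangent_perp M p v (c : R) :
  (forall x, M x -> dotp x x = c) -> tangent M p v -> dotp p v = 0.
Proof.
move=> Mc [g [Mg gp gv]].
have : is_derive (0 : R) 1 (fun t => dotp (g t) (g t)) 0.
  apply: near_eq_is_derive (is_derive_cst c _ _).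
  by near=> t; rewrite Mc//; near: t.
case=> _; have [_ ->] := is_derive_dotp gv gv.
rewrite gp (dotpC v); lra.
Unshelve. all: by end_near. Qed.

(** Any candidate gradient [u] is tangent, so its squared norm is the derivative of [f] along [u],
    which is zero. *)
Lemma grad_cst_on M (f : 'rV[R]_k -> R) a p :
  (forall x, M x -> f x = a) -> tangent M p 0 -> grad M f p = 0.
Proof.
move=> fa T0; have d0 v : tangent M p v -> mderive M f p v = 0.
  by move=> Tv; apply: mderiveE => //; exact: is_mderive_cst_on fa.
apply: xget_unique => [|u [Tu fu]]; first by split=> // v /d0->; rewrite dotp0l.
by apply: dotp_eq0; rewrite -fu// d0.
Qed.

Lemma tproj0 T : T 0 -> tproj T 0 = 0.
Proof.
move=> T0; apply: xget_unique => [|u [Tu uT]].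
  by split=> // w _; rewrite subrr dotp0l.
by apply/dotp_eq0/oppr_inj; rewrite -dotpNl oppr0 -(uT u Tu) sub0r.
Qed.

(** The gradient vanishes on all of [M], so its derivative along each frame vector is zero; the
    frame being a genuine basis ensures that its rows are tangent. *)
Lemma laplacian_cst_on d M (f : 'rV[R]_k -> R) a p :
  (forall x, M x -> f x = a) -> (forall x, M x -> tangent M x 0) -> M p ->
  orthonormal_basis (tangent M p) (frame d M p) -> laplacian d M f p = 0.
Proof.
move=> fa T0 Mp [_ eT]; rewrite /laplacian big1// => i _; rewrite /hess /covd.
rewrite (mderiveE (d := 0)) ?tproj0 ?dotp0l//.
- exact: T0.
- by apply/eT; exact: row_sub.
- by apply: is_mderive_cst_on => x Mx; apply: grad_cst_on fa _; exact: T0.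
Qed.

End Submanifolds.

(** * Product bases, the Frobenius norm as a trace, and tangent spaces of spheres *)

Lemma orthonormal_basis_block (R : realType) k1 k2 d1 d2 (T1 : set 'rV[R]_k1)
    (T2 : set 'rV[R]_k2) (B1 : 'M[R]_(d1, k1)) (B2 : 'M[R]_(d2, k2)) :
  orthonormal_basis T1 B1 -> orthonormal_basis T2 B2 ->
  orthonormal_basis [set v | T1 (lsubmx v) /\ T2 (rsubmx v)]
    (block_mx B1 0 0 B2).
Proof.
move=> [B11 T1E] [B22 T2E]; split.
  rewrite tr_block_mx !trmx0 mulmx_block !(mulmx0, mul0mx, addr0, add0r) B11 B22.
  by rewrite -scalar_mx_block.
move=> v; rewrite /= T1E T2E; split=> [[/submxP[y1 v1] /submxP[y2 v2]]|].
  apply/submxP; exists (row_mx y1 y2).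
  by rewrite mul_row_block !mulmx0 addr0 add0r -v1 -v2 hsubmxK.
move=> /submxP[y ->]; rewrite -[y]hsubmxK mul_row_block !mulmx0 addr0 add0r.
by rewrite row_mxKl row_mxKr !submxMl.
Qed.

Lemma sum_sqr_mxtrace (R : realType) m n (S : 'M[R]_(m, n)) :
  \sum_i \sum_j S i j ^+ 2 = \tr (S *m S^T).
Proof.
by apply: eq_bigr => i _; rewrite mxE; apply: eq_bigr => j _; rewrite mxE expr2.
Qed.

Lemma tangent_round_sphere (R : realType) k (r : R) (p v : 'rV[R]_k) :
  0 < r -> dotp p p = r ->
  tangent [set x | dotp x x = r] p v <-> dotp p v = 0.
Proof.
move=> r0 pr; split; first by apply: (tangent_perp (c := r)).
move=> /sphere_curve; rewrite pr => /(_ r0)[g [gr g0 gv]].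
by exists g; split=> //; near=> t; apply: gr.
Unshelve. all: by end_near. Qed.

(** * Tangent spaces, unit normals and second fundamental form of a product of spheres of squared
    radii [a] and [b] *)

Section ProductOfSpheres.
Context {R : realType} {k1 k2 : nat} (a b : R).
Hypotheses (a_gt0 : 0 < a) (b_gt0 : 0 < b).
Local Notation E := 'rV[R]_(k1 + k2).
Let N : set E := [set x | dotp x x = a + b].
Let M : set E :=
  [set x | dotp (lsubmx x) (lsubmx x) = a /\ dotp (rsubmx x) (rsubmx x) = b].

(** A curve in the product projects to curves in the two spheres; conversely, two curves given by
    [sphere_curve] are paired. *)
Lemma tangent_product p v : M p ->
  tangent M p v <->
  dotp (lsubmx p) (lsubmx v) = 0 /\ dotp (rsubmx p) (rsubmx v) = 0.
Proof.
move=> [pa pb]; split=> [[g [gM g0 /is_derive_mxP gv]]|[v1 v2]].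
  split; [apply: (tangent_perp (M := [set x | dotp x x = a]) (c := a))|
          apply: (tangent_perp (M := [set x | dotp x x = b]) (c := b))] => //.
  - exists (fun t => lsubmx (g t)); split; last 1 first.
    + apply/is_derive_mxP => i j; rewrite mxE.
      by under eq_fun do rewrite mxE; exact: gv.
    + by near=> t; have [] : M (g t) by near: t.
    + by rewrite g0.
  - exists (fun t => rsubmx (g t)); split; last 1 first.
    + apply/is_derive_mxP => i j; rewrite mxE.
      by under eq_fun do rewrite mxE; exact: gv.
    + by near=> t; have [] : M (g t) by near: t.
    + by rewrite g0.
have [|g1 [g1a g10 g1v]] := sphere_curve _ v1; first by rewrite pa.
have [|g2 [g2b g20 g2v]] := sphere_curve _ v2; first by rewrite pb.
exists (fun t => row_mx (g1 t) (g2 t)); split.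
- by near=> t; split; rewrite ?row_mxKl ?row_mxKr ?g1a ?g2b.
- by rewrite g10 g20 hsubmxK.
- by rewrite -[v]hsubmxK; exact: is_derive_row_mx.
Unshelve. all: by end_near. Qed.

Lemma tangent_product0 p : M p -> tangent M p 0.
Proof. by move=> Mp; apply/tangent_product; rewrite // !linear0 !dotp0r. Qed.

(* [shape] is, up to sign, the shape operator of M in N: the unit normals of M
   at x are [x *m shape] and its opposite. *)
Variables (alpha beta : R).
Hypotheses (ab_orth : alpha * a + beta * b = 0).
Hypotheses (ab_unit : alpha ^+ 2 * a + beta ^+ 2 * b = 1).
Let shape : 'M[R]_(k1 + k2) := block_mx alpha%:M 0 0 beta%:M.

Lemma mul_shape (x : E) :
  x *m shape = row_mx (alpha *: lsubmx x) (beta *: rsubmx x).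
Proof.
by rewrite -{1}[x]hsubmxK mul_row_block !mulmx0 addr0 add0r !mul_mx_scalar.
Qed.

(** Testing [u] against tangent vectors (w, 0) and (0, w) shows that its blocks are multiples l and
    r of those of [p]. For the inner product on R^2 with weights [a] and [b], both (l, r) and
    (alpha, beta) are unit vectors orthogonal to (1, 1), so they agree up to sign. *)
Lemma unit_normalE p u : M p -> tangent N p u -> dotp u u = 1 ->
    (forall v, tangent M p v -> dotp u v = 0) ->
  u = dotp u (p *m shape) *: (p *m shape) /\ dotp u (p *m shape) ^+ 2 = 1.
Proof.
move=> Mp; have [pa pb] := Mp => /(tangent_perp (c := a + b)) => /(_ (fun _ => id)).
rewrite dotp_submx => pu u1 uM.
have [l ul] : exists l, lsubmx u = l *: lsubmx p.
  eexists; apply: perp_perp => [|w pw]; first by rewrite pa.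
  have := uM (row_mx w 0); rewrite dotp_submx row_mxKl row_mxKr dotp0r addr0; apply.
  by apply/tangent_product; rewrite // row_mxKl row_mxKr dotp0r.
have [r ur] : exists r, rsubmx u = r *: rsubmx p.
  eexists; apply: perp_perp => [|w pw]; first by rewrite pb.
  have := uM (row_mx 0 w); rewrite dotp_submx row_mxKl row_mxKr dotp0r add0r; apply.
  by apply/tangent_product; rewrite // row_mxKl row_mxKr dotp0r.
have lr : l * a + r * b = 0.
  by move: pu; rewrite ul ur !dotpZr pa pb.
have lr1 : l ^+ 2 * a + r ^+ 2 * b = 1.
  by move: u1; rewrite dotp_submx ul ur !dotpZr !dotpZl pa pb !mulrA -!expr2.
have -> : dotp u (p *m shape) = l * alpha * a + r * beta * b.
  by rewrite dotp_submx mul_shape row_mxKl row_mxKr ul ur !dotpZr !dotpZl pa pb; ring.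
have lE : l = - r * b / a.
  by apply: (mulIf (lt0r_neq0 a_gt0)); rewrite divfK ?lt0r_neq0//; lra.
have aE : alpha = - beta * b / a.
  apply: (mulIf (lt0r_neq0 a_gt0)); rewrite divfK ?lt0r_neq0//.
  by rewrite mulNr -(addr0_eq ab_orth) opprK.
(* Two vectors of the plane orthogonal to (1, 1) are parallel. *)
have la : l * beta = r * alpha by rewrite lE aE; field; rewrite gt_eqF.
have e1 : (l * alpha * a + r * beta * b) * alpha = l.
  transitivity (l * (alpha ^+ 2 * a) + r * alpha * beta * b); first by ring.
  rewrite -la; transitivity (l * (alpha ^+ 2 * a + beta ^+ 2 * b)); first by ring.
  by rewrite ab_unit mulr1.
have e2 : (l * alpha * a + r * beta * b) * beta = r.
  transitivity (l * beta * alpha * a + r * (beta ^+ 2 * b)); first by ring.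
  rewrite la; transitivity (r * (alpha ^+ 2 * a + beta ^+ 2 * b)); first by ring.
  by rewrite ab_unit mulr1.
split.
  by rewrite mul_shape scale_row_mx !scalerA e1 e2 -ul -ur hsubmxK.
move: e1 e2; set eps := _ + _ => e1 e2.
rewrite -lr1 -e1 -e2 -[LHS]mulr1 -ab_unit; ring.
Qed.

Variable nu : E -> E.
Hypothesis nu_normal : unit_normal_field N M nu.

Lemma is_mderive_unit_normal p v : M p -> tangent M p v ->
  is_mderive M nu p v (dotp (nu p) (p *m shape) *: (v *m shape)).
Proof.
move=> Mp Tv; have [_ _ _ [dF dFE]] := nu_normal Mp.
have nuE x : M x -> nu x = dotp (nu x) (x *m shape) *: (x *m shape) /\
    dotp (nu x) (x *m shape) ^+ 2 = 1.
  by move=> Mx; have [? ? ? _] := nu_normal Mx; apply: unit_normalE.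
move=> g gM; have nug := dFE v Tv g gM; have [Mg g0 gv] := gM.
have gS := is_derive_mulmx shape gv.
(* The sign of the normal along the curve, differentiable because [nu] is. *)
pose eps t := dotp (nu (g t)) (g t *m shape).
have [de epsd] : exists de, is_derive (0 : R) 1 eps de.
  by eexists; exact: is_derive_dotp nug gS.
(* Differentiating eps^2 = 1 gives 2 eps(0) de = 0, and eps(0) is nonzero. *)
have de0 : de = 0.
  have : is_derive (0 : R) 1 (fun t => eps t * eps t) 0.
    apply: near_eq_is_derive (is_derive_cst (1 : R) _ _).
    by near=> t; rewrite -expr2 (nuE _ _).2//; near: t.
  case=> _; have [_ ->] := is_derive_mull epsd epsd.
  move=> /eqP; rewrite (mulrC de) -mulr2n mulrn_eq0/= mulf_eq0 => /orP[|/eqP//].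
  move=> /eqP eps0; have := (nuE _ Mp).2; rewrite -g0 -/(eps 0) eps0 expr0n/=.
  by move=> /esym/eqP; rewrite oner_eq0.
have := is_derive_scale epsd gS; rewrite de0 scale0r add0r /eps g0.
apply: near_eq_is_derive; near=> t.
by rewrite /= -(nuE _ _).1//; near: t.
Unshelve. all: by end_near. Qed.

(** The derivative of [nu] along [v] is a multiple of [v *m shape], which is orthogonal to [p] block
    by block; it is already tangent to [N], and the projection fixes it. *)
Lemma second_formE p v w : M p -> tangent M p v ->
  second_form N M nu p v w =
  - (dotp (nu p) (p *m shape) * dotp (v *m shape) w).
Proof.
move=> Mp Tv; rewrite /second_form /covd.
rewrite (mderiveE Tv (is_mderive_unit_normal Mp Tv)).
have Np : dotp p p = a + b by rewrite dotp_submx Mp.1 Mp.2.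
have TN u : tangent N p u <-> dotp p u = 0.
  by apply: tangent_round_sphere; rewrite ?addr_gt0.
have [v1 v2] := (tangent_product v Mp).1 Tv.
rewrite tproj_id ?dotpZl// => [u z /TN pu /TN pz|].
  by apply/TN; rewrite dotpDr dotpNr pu pz subr0.
apply/TN; rewrite dotpZr; move: (dotp (nu p) _) => s.
rewrite dotp_submx mul_shape row_mxKl row_mxKr !dotpZr v1 v2.
by rewrite !mulr0 addr0 mulr0.
Qed.

End ProductOfSpheres.

(** * Frames of a product of spheres and the norm of its second fundamental form *)

Section ProductOfSpheresFrames.
Context {R : realType} {m q : nat} (a b : R).
Hypotheses (a_gt0 : 0 < a) (b_gt0 : 0 < b).
Local Notation E := 'rV[R]_(m.+1 + q.+1).
Let N : set E := [set x | dotp x x = a + b].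
Let M : set E :=
  [set x | dotp (lsubmx x) (lsubmx x) = a /\ dotp (rsubmx x) (rsubmx x) = b].

Lemma product_orthonormal_basis p : M p ->
  exists (B1 : 'M[R]_(m, m.+1)) (B2 : 'M[R]_(q, q.+1)),
    [/\ B1 *m B1^T = 1%:M, B2 *m B2^T = 1%:M &
        orthonormal_basis (tangent M p) (block_mx B1 0 0 B2)].
Proof.
move=> Mp; have [pa pb] := Mp.
have [|B1 oB1] := @hyperplane_orthonormal R m (lsubmx p); first by rewrite pa.
have [|B2 oB2] := @hyperplane_orthonormal R q (rsubmx p); first by rewrite pb.
exists B1, B2; split; [exact: oB1.1|exact: oB2.1|].
have -> : tangent M p =
    [set v | dotp (lsubmx p) (lsubmx v) = 0 /\ dotp (rsubmx p) (rsubmx v) = 0].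
  by apply/seteqP; split=> v /tangent_product; apply.
exact: (orthonormal_basis_block oB1 oB2).
Qed.

(** Since a basis exists, [xget] does not return its default. The dimension [n] is kept apart from
    [m + q] because the theorem has [q] equal to [n - m]. *)
Lemma frame_product n p : n = (m + q)%N -> M p ->
  orthonormal_basis (tangent M p) (frame n M p).
Proof.
move=> -> /product_orthonormal_basis[B1 [B2 [_ _ oB]]].
exact: (xgetI (P := [set e | orthonormal_basis (tangent M p) e]) 0 oB).
Qed.

Lemma norm_second_form_product n (alpha beta : R) nu p :
  alpha * a + beta * b = 0 -> alpha ^+ 2 * a + beta ^+ 2 * b = 1 ->
  n = (m + q)%N -> unit_normal_field N M nu -> M p ->
  norm_second_form n N M nu p =
  Num.sqrt (alpha ^+ 2 * m%:R + beta ^+ 2 * q%:R).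
Proof.
move=> ab0 ab1 nE nuN Mp; have := frame_product nE Mp.
have [B1 [B2 [B11 B22 oB]]] := product_orthonormal_basis Mp.
rewrite /norm_second_form; move: (frame _ _ _) => e oe; congr Num.sqrt.
pose D : 'M[R]_(m.+1 + q.+1) := block_mx alpha%:M 0 0 beta%:M.
transitivity (\sum_i \sum_j (e *m D *m e^T) i j ^+ 2).
  apply: eq_bigr => i _; apply: eq_bigr => j _.
  rewrite (second_formE a_gt0 b_gt0 ab0 ab1)//; last first.
    by apply/oe.2; exact: row_sub.
  (* The sign of the normal disappears on squaring. *)
  have [? ? ? _] := nuN _ Mp; rewrite sqrrN exprMn.
  rewrite (unit_normalE a_gt0 b_gt0 ab0 ab1 Mp _ _ _).2// mul1r -row_mul.
  by rewrite [in RHS]mxE /dotp; congr (_ ^+ 2); apply: eq_bigr => l _; rewrite !mxE.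
rewrite sum_sqr_mxtrace.
have trD : D^T = D by rewrite tr_block_mx !tr_scalar_mx !trmx0.
(* By cyclicity the trace involves [e] only through the projection [e^T *m e], so the arbitrary
   frame may be replaced by the block basis. *)
rewrite !trmx_mul trmxK trD -mulmxA mxtrace_mulC !mulmxA.
rewrite -[_ *m e^T *m e]mulmxA (orthonormal_basis_proj oe oB).
rewrite tr_block_mx !trmx0 !mulmx_block !(mulmx0, mul0mx, addr0, add0r).
rewrite mxtrace_block !mul_mx_scalar -!scalemxAl !scalerA !mxtraceZ -!expr2.
(* The trace of a projection is its rank. *)
have trP d (B : 'M[R]_(d, d.+1)) : B *m B^T = 1%:M ->
    \tr (B^T *m B *m (B^T *m B)) = d%:R.
  move=> BB; rewrite mulmxA -[_ *m B *m _]mulmxA BB mulmx1.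
  by rewrite mxtrace_mulC BB mxtrace1.
by rewrite !trP.
Qed.

End ProductOfSpheresFrames.

(** * Simons' equation for the Clifford hypersurface *)

Unset Implicit Arguments.
Set Strict Implicit.
Set Printing Implicit Defensive.

Theorem proposition3p3 (R : realType) (n m : nat) (c : R)
    (n_ge2 : (2 <= n)%N) (c_gt0 : 0 < c) (m_bounds : (1 <= m <= n - 1)%N)
    (nu : 'rV[R]_(m.+1 + (n - m).+1) -> 'rV[R]_(m.+1 + (n - m).+1))
    (nu_normal : unit_normal_field (space_form n m c) (clifford n m c) nu) :
  let M := clifford n m c in
  let A := norm_second_form n (space_form n m c) M nu in
  forall p, M p ->
    [/\ mdifferentiable M A p,
        mdifferentiable M (grad M A) p &
        A p * laplacian n M A p + A p ^+ 4
        = 2 / n%:R * dotp (grad M A p) (grad M A p) + n%:R * c * A p ^+ 2].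
Proof.
move=> M A p Mp.
have [m_gt0 m_lt] : (0 < m /\ m < n)%N by case/andP: m_bounds => ? ?; split=> //; lia.
have nE : n = (m + (n - m))%N by rewrite subnKC// ltnW.
have m0 : (0 : R) < m%:R by rewrite ltr0n.
have q0 : (0 : R) < (n - m)%:R by rewrite ltr0n subn_gt0.
have nR : n%:R = m%:R + (n - m)%:R :> R by rewrite -natrD -nE.
have n0 : (0 : R) < n%:R by rewrite nR addr_gt0.
pose a : R := m%:R / (c * n%:R); pose b : R := (n - m)%:R / (c * n%:R).
have a0 : 0 < a by rewrite divr_gt0 ?mulr_gt0.
have b0 : 0 < b by rewrite divr_gt0 ?mulr_gt0.
have ME : M = [set x | dotp (lsubmx x) (lsubmx x) = a /\
                       dotp (rsubmx x) (rsubmx x) = b].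
  by rewrite /M /clifford /sphere /= !sqr_sqrtr ?ltW.
have NE : space_form n m c = [set x | dotp x x = a + b].
  rewrite /space_form (_ : 1 / c = a + b)// /a /b nR; field.
  by rewrite -nR !lt0r_neq0.
(* Up to a common sign these are the two principal curvatures, obtained by solving alpha a + beta b
   = 0 and alpha^2 a + beta^2 b = 1. *)
pose alpha := Num.sqrt (c * (n - m)%:R / m%:R).
pose beta := - (alpha * m%:R / (n - m)%:R).
have alpha2 : alpha ^+ 2 = c * (n - m)%:R / m%:R.
  by rewrite sqr_sqrtr// divr_ge0 ?mulr_ge0// ltW.
have beta2 : beta ^+ 2 = c * m%:R / (n - m)%:R.
  by rewrite /beta sqrrN !exprMn alpha2; field; rewrite !lt0r_neq0.
have AE x : M x -> A x = Num.sqrt (n%:R * c).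
  (* The two terms of |A|^2 are c (n - m) and c m. *)
  rewrite /A NE -/M => Mx; rewrite (_ : n%:R * c = alpha ^+ 2 * m%:R +
    beta ^+ 2 * (n - m)%:R); last first.
    by rewrite alpha2 beta2 nR; field; rewrite !lt0r_neq0.
  have nu' := nu_normal; rewrite NE -/M ME in nu'; rewrite ME in Mx *.
  apply: (norm_second_form_product a0 b0 _ _ nE nu' Mx).
  - by rewrite /beta /a /b; field; rewrite !lt0r_neq0.
  - by rewrite alpha2 beta2 /a /b nR; field; rewrite -nR !lt0r_neq0.
have T0 x : M x -> tangent M x 0 by rewrite ME; exact: tangent_product0.
have gradE x : M x -> grad M A x = 0.
  by move=> Mx; apply: grad_cst_on AE _; exact: T0.
have lap0 : laplacian n M A p = 0.
  apply: (laplacian_cst_on AE T0 Mp).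
  by move: Mp; rewrite ME; apply: frame_product.
split; [exact: mdifferentiable_cst_on AE|exact: mdifferentiable_cst_on gradE|].
(* Both sides reduce to (n c)^2. *)
rewrite lap0 gradE// dotp0l !mulr0 !add0r AE// -[4%N]/(2 * 2)%N exprM.
by rewrite sqr_sqrtr ?mulr_ge0 ?ltW// expr2.
Qed.
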